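(* Let $f\in\mathbb{C}[x_0,\ldots,x_n]_d$ be a concise form, let $A=Q/\operatorname{Ann}(f)$ be the associated algebra, and let $k\in\{1,\ldots,\lfloor d/2\rfloor\}$. If $\underline{rk}(f)=\dim A_k$ and $\operatorname{hess}_f^k=0$, then $$wrk(f)>\underline{rk}(f).$$ In particular, every concise form of minimal border rank (that is, $\underline{rk}(f)=\dim A_1$) and with vanishing Hessian ($\operatorname{hess}_f=0$) has Waring rank greater than its border rank.
   Context: $Q=\mathbb{C}[X_0,\ldots,X_n]$ acts on $R=\mathbb{C}[x_0,\ldots,x_n]$ by $X_i=\partial/\partial x_i$; $\operatorname{Ann}(f)=\{\alpha\in Q:\alpha(f)=0\}$ and $A=Q/\operatorname{Ann}(f)=\bigoplus_{i=0}^d A_i$. The form $f$ is concise if $\operatorname{Ann}(f)_1=0$. $\operatorname{hess}_f^k=\det[\alpha_i\alpha_j(f)]_{i,j}$, where $(\alpha_i)$ is a basis of $A_k$; $\operatorname{hess}_f=\operatorname{hess}_f^1$. The Waring rank $wrk(f)$ is the least number of terms in an expression $f=l_1^d+\cdots+l_s^d$ with $l_i$ linear forms. The border rank $\underline{rk}(f)$ is the least $s$ such that $[f]\in\mathbb{P}(R_d)$ lies in the $s$-th secant variety $S^s(X)=\overline{\bigcup_{p_1,\ldots,p_s\in X}\langle p_1,\ldots,p_s\rangle}$ of the Veronese variety $X=\mathcal{V}_d(\mathbb{P}^n)=\{[l^d]:l\in R_1\setminus\{0\}\}\subset\mathbb{P}(R_d)$.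
   Formalization: In the ''in particular'' sentence the degree d is assumed to be at least 2 (so that k = 1 is at most ⌊d/2⌋); for d = 1 it fails, as f = x_0 with n = 0 is concise with vanishing Hessian and has Waring rank and border rank both 1. *)

(* Defs.v *)
From HB Require Import structures.
From mathcomp Require Import all_boot all_order all_algebra.
From mathcomp Require Import classical_sets reals complex ssrcomplements mpoly.

Set Implicit Arguments.
Unset Strict Implicit.
Unset Printing Implicit Defensive.

Import GRing.Theory.
Local Open Scope ring_scope.

(* The least element of P.  Junk value 0 when P is empty; this does
   not happen for the two ranks of a nonzero form of positive degree over C. *)
Definition least (P : set nat) : nat :=
  xget 0%N [set s | P s /\ forall t, P t -> (s <= t)%N]%classic.

Section Apolarity.
Variables (F : fieldType) (n : nat).

(* alpha(f), where the variable 'X_i of alpha acts as d/dx_i: both Q and R are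
   {mpoly F[n]}. *)
Definition apply_diff (alpha f : {mpoly F[n]}) : {mpoly F[n]} :=
  \sum_(m <- msupp alpha) alpha@_m *: f^`M[m].

Definition Ann (f : {mpoly F[n]}) : {pred {mpoly F[n]}} :=
  [pred alpha | apply_diff alpha f == 0].

Lemma apply_diffwE k (alpha f : {mpoly F[n]}) : (msize alpha <= k)%N ->
  apply_diff alpha f = \sum_(m : 'X_{1..n < k}) alpha@_m *: f^`M[m].
Proof.
move=> le_k; rewrite /apply_diff (big_mksub 'X_{1..n < k}) //=.
- rewrite big_rmcond //= => m.
  by rewrite -mcoeff_eq0 => /eqP->; rewrite scale0r.
- exact: msupp_uniq.
- by move=> m /msize_mdeg_lt /leq_trans; apply.
Qed.

Lemma apply_diff_linear (f : {mpoly F[n]}) : linear (apply_diff^~ f).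
Proof.
move=> c p q; set k := maxn (msize (c *: p + q)) (maxn (msize p) (msize q)).
rewrite !(@apply_diffwE k) ?leq_max ?leqnn ?orbT //.
rewrite scaler_sumr -big_split /=; apply: eq_bigr => m _.
by rewrite mcoeffD mcoeffZ scalerDl scalerA.
Qed.

Lemma mderivm_homog (d : nat) (m : 'X_{1..n}) (f : {mpoly F[n]}) :
  f \is d.-homog -> f^`M[m] \is (d - mdeg m).-homog.
Proof.
move=> /dhomogP hf; apply/dhomogP => m'.
rewrite mcoeff_msupp mcoeff_mderivm => nz.
have /hf <- : (m + m')%MM \in msupp f.
  by rewrite mcoeff_msupp; apply: contraNneq nz => ->; rewrite mul0rn.
by rewrite /= mdegD addKn.
Qed.

Lemma apply_diff_homog (k d : nat) (alpha f : {mpoly F[n]}) :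
  alpha \is k.-homog -> f \is d.-homog ->
  apply_diff alpha f \is (d - k).-homog.
Proof.
move=> /dhomogP ha hf; rewrite /apply_diff big_seq; apply: rpred_sum => m hm.
by apply: rpredZ; rewrite -(ha _ hm); apply: mderivm_homog.
Qed.

End Apolarity.

Section Forms.
Variables (F : fieldType) (n d : nat).
Local Notation form := (dhomog n.+1 F).

(* The map Q_k -> R_(d-k), alpha |-> alpha(f). *)
Definition catalecticant (f : form d) (k : nat) (alpha : form k) :
  form (d - k) := DHomog (apply_diff_homog (valP alpha) (valP f)).

Lemma catalecticant_linear (f : form d) (k : nat) :
  linear (@catalecticant f k).
Proof. by move=> c p q; apply: val_inj; apply: apply_diff_linear. Qed.

HB.instance Definition _ (f : form d) (k : nat) :=
  GRing.isLinear.Build F (form k) (form (d - k)) _ (@catalecticant f k)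
    (@catalecticant_linear f k).

Definition Ann_deg (f : form d) (k : nat) : {vspace form k} :=
  lker (linfun (@catalecticant f k)).

Lemma mem_Ann_deg (f : form d) (k : nat) (alpha : form k) :
  (alpha \in Ann_deg f k) = (val alpha \in Ann (val f)).
Proof. by rewrite memv_ker lfunE. Qed.

Definition concise (f : form d) : Prop := Ann_deg f 1 = 0%VS.

(* A_k = Q_k / Ann(f)_k. *)
Definition dimA (f : form d) (k : nat) : nat :=
  (\dim (fullv : {vspace form k}) - \dim (Ann_deg f k))%N.

(* The classes of the alpha_i form a basis of A_k: each element of Q_k is
   congruent modulo Ann(f) to exactly one linear combination of them. *)
Definition basisA (f : form d) (k : nat)
    (alpha : (dimA f k).-tuple (form k)) : Prop :=
  forall beta : form k, exists! c : {ffun 'I_(dimA f k) -> F},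
    beta - \sum_i c i *: tnth alpha i \in Ann_deg f k.

(* hess_f^k computed in the basis (alpha_i); another basis changes it by a
   nonzero constant factor. *)
Definition hess (f : form d) (k r : nat) (alpha : r.-tuple (form k)) :
    {mpoly F[n.+1]} :=
  \det (\matrix_(i < r, j < r)
    apply_diff (val (tnth alpha i) * val (tnth alpha j)) (val f)).

Definition waring_rank (f : form d) : nat :=
  least [set s | exists l : 'I_s -> form 1,
    val f = \sum_(i < s) val (l i) ^+ d]%classic.

(* Subsets of a projective space P(V) are given by representatives in V \ {0}.
   The closure is the Zariski closure: the common zeros of all homogeneous
   polynomials in linear coordinates of V that vanish on S. *)
Definition proj_closure (V : vectType F) (S : set V) : set V :=
  [set v | v != 0 /\
    forall (e : nat) (P : {mpoly F[\dim (fullv : {vspace V})]}),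
      P \is e.-homog ->
      (forall u, S u -> P.@[fun i => coord (vbasis fullv) i u] = 0) ->
      P.@[fun i => coord (vbasis fullv) i v] = 0]%classic.

(* The point [l^d] is represented by l^d only, not by its nonzero multiples:
   the linear spans below do not depend on this choice. *)
Definition veronese : set (form d) :=
  [set p | exists2 l : form 1, l != 0 & val p = val l ^+ d]%classic.

Definition secant_variety (s : nat) : set (form d) :=
  proj_closure [set g | g != 0 /\ exists2 p : s.-tuple (form d),
    forall i, veronese (tnth p i) & g \in <<p>>%VS]%classic.

Definition border_rank (f : form d) : nat :=
  least [set s | secant_variety s f]%classic.

End Forms.

(* Main.v *)
(** Write f as a sum of s = wrk(f) powers l_t^d.  A form alpha of degree e acts
    by alpha(l_t^d) = d!/(d-e)! alpha(l_t) l_t^(d-e), where alpha(l_t) is the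
    value of alpha at the coefficient vector of l_t.  Hence a form vanishing at
    all the l_t kills f, so for a basis (alpha_i) of A_k the matrix
    E = (alpha_i(l_t)) has independent rows, and dim A_k <= s.  If s = dim A_k,
    then E is invertible and hess_f^k is a nonzero multiple of
    det(E)^2 * prod_t l_t^(d-2k), which is nonzero. *)

Require Import Defs.
From HB Require Import structures.
From mathcomp Require Import all_boot all_order all_algebra.
From mathcomp Require Import classical_sets reals complex mpoly.
Local Open Scope ring_scope.

Set Implicit Arguments.
Unset Strict Implicit.
Unset Printing Implicit Defensive.

Import GRing.Theory Num.Theory.

(** * Derivatives of powers of linear forms *)

(** This is the word over which [mderivm_foldr] folds, so mixed derivatives can be computed by
    induction on it. *)
Definition mnm_word n (m : 'X_{1..n}) : seq 'I_n :=
  flatten [seq nseq (m i) i | i <- enum 'I_n].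

Lemma prod_mnm_word (R : comNzRingType) n (m : 'X_{1..n}) (F : 'I_n -> R) :
  \prod_(i <- mnm_word m) F i = \prod_(i < n) F i ^+ m i.
Proof.
rewrite big_flatten big_map /= big_enum /=; apply: eq_bigr => i _.
by rewrite big_nseq -Monoid.iteropE.
Qed.

Lemma size_mnm_word n (m : 'X_{1..n}) : size (mnm_word m) = mdeg m.
Proof.
rewrite size_flatten /shape -map_comp sumnE big_map big_enum mdegE /=.
by apply: eq_bigr => i _; rewrite /= size_nseq.
Qed.

Definition lincoef (F : fieldType) n (l : {mpoly F[n]}) : 'I_n -> F :=
  fun i => l@_U_(i).

Lemma mderiv_linform (F : fieldType) n (l : {mpoly F[n]}) i :
  l \is 1.-homog -> l^`M(i) = (lincoef l i)%:MP.
Proof.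
move=> hl; apply/mpolyP => m; rewrite mcoeff_deriv mcoeffC.
have [->|m0] := eqVneq m 0%MM; first by rewrite add0m mnm0E mulr1.
rewrite (dhomog_nemf_coeff hl) ?mul0rn ?(negPf m0) ?mulr0 //=.
by rewrite mdegD mdeg1 addn1 eqSS mdeg_eq0.
Qed.

Lemma mderiv_linform_exp (F : fieldType) n (l : {mpoly F[n]}) i d :
  l \is 1.-homog ->
  (l ^+ d)^`M(i) = (lincoef l i *+ d) *: l ^+ d.-1.
Proof.
move=> hl; elim: d => [|d IHd]; first by rewrite expr0 mulr0n scale0r mderivC.
rewrite exprS mderivM IHd mderiv_linform // mul_mpolyC -scalerAr.
case: d {IHd} => [|d]; first by rewrite mulr0n scale0r addr0.
by rewrite -exprS /= -scalerDl -mulrS.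
Qed.

(** When [mdeg m] exceeds [d] the falling factorial is 0, so the truncated exponent does no harm. *)
Lemma mderivm_linform_exp (F : fieldType) n (l : {mpoly F[n]}) m d :
  l \is 1.-homog ->
  (l ^+ d)^`M[m] =
    ((\prod_(i < n) lincoef l i ^+ m i) *+ (d ^_ mdeg m)%N) *: l ^+ (d - mdeg m).
Proof.
move=> hl; rewrite mderivm_foldr -/(mnm_word m) -prod_mnm_word -size_mnm_word.
elim: (mnm_word m) => [|i w IHw] /=.
  by rewrite big_nil ffactn0 subn0 scale1r.
rewrite IHw mderivZ mderiv_linform_exp // scalerA big_cons ffactnSr -subnS.
by rewrite mulrnAr mulrnAl -mulrnA mulrC.
Qed.

Lemma apply_diff_linform_exp (F : fieldType) n (l : {mpoly F[n]}) k d alpha :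
  l \is 1.-homog -> alpha \is k.-homog ->
  apply_diff alpha (l ^+ d) =
    (alpha.@[lincoef l] *+ (d ^_ k)%N) *: l ^+ (d - k).
Proof.
move=> hl /dhomogP ha; rewrite /apply_diff mevalE -sumrMnl scaler_suml.
apply: eq_big_seq => m /ha <-.
by rewrite mderivm_linform_exp // scalerA mulrnAr.
Qed.

Lemma apply_diff_sum (F : fieldType) n (alpha : {mpoly F[n]}) (I : finType)
    (g : I -> {mpoly F[n]}) :
  apply_diff alpha (\sum_i g i) = \sum_i apply_diff alpha (g i).
Proof.
rewrite /apply_diff exchange_big; apply: eq_bigr => m _ /=.
by rewrite linear_sum scaler_sumr.
Qed.

(** * Existence of Waring decompositions *)

(** The number of terms is left free, which gives closure under addition. *)
Definition waring_sum (F : fieldType) n d (g : {mpoly F[n]}) : Prop :=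
  exists s : seq (dhomog n F 1), g = \sum_(l <- s) val l ^+ d.

Lemma waring_sumD (F : fieldType) n d (g h : {mpoly F[n]}) :
  waring_sum d g -> waring_sum d h -> waring_sum d (g + h).
Proof.
by move=> [s ->] [t ->]; exists (s ++ t); rewrite big_cat.
Qed.

Lemma waring_sum_big (F : fieldType) n d (I : Type) (r : seq I) (P : pred I)
    (g : I -> {mpoly F[n]}) :
  (forall i, P i -> waring_sum d (g i)) -> waring_sum d (\sum_(i <- r | P i) g i).
Proof.
move=> gP; apply: (big_ind (waring_sum d)) => //; last exact: waring_sumD.
by exists [::]; rewrite big_nil.
Qed.

(** Algebraic closedness enters here: a [d]-th root of [c] is absorbed into each linear form. *)
Lemma waring_sumZ (F : numClosedFieldType) n d c (g : {mpoly F[n]}) :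
  (0 < d)%N -> waring_sum d g -> waring_sum d (c *: g).
Proof.
move=> d0 [s ->]; exists [seq d.-root c *: l | l <- s].
rewrite big_map scaler_sumr; apply: eq_bigr => l _.
by rewrite linearZ /= exprZn rootCK.
Qed.

(* The Vandermonde matrix of the nodes 0, ..., N-1 is invertible, so each
   coefficient is a linear combination of values. *)
Lemma waring_sum_coef (F : numClosedFieldType) n d N (w : 'I_N -> {mpoly F[n]}) :
  (0 < d)%N -> (forall t : F, waring_sum d (\sum_(i < N) t ^+ i *: w i)) ->
  forall i, waring_sum d (w i).
Proof.
move=> d0 wP i; pose V := Vandermonde N (\row_(j < N) (j%:R : F)).
have Vunit : V \in unitmx.
  rewrite unitmxE unitfE det_Vandermonde; apply/prodf_neq0 => a _.
  apply/prodf_neq0 => b ltab; rewrite !mxE subr_eq0 eqr_nat.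
  by rewrite gtn_eqF.
suff -> : w i = \sum_j invmx V j i *: \sum_(a < N) (j%:R : F) ^+ a *: w a.
  by apply: waring_sum_big => j _; apply: waring_sumZ.
under eq_bigr do rewrite scaler_sumr.
rewrite exchange_big /= -[LHS]scale1r.
transitivity (\sum_a (V *m invmx V) a i *: w a).
  rewrite mulmxV // (bigD1 i) //= !mxE eqxx big1 ?addr0 // => a neq_ai.
  by rewrite mxE (negPf neq_ai) scale0r.
apply: eq_bigr => a _; rewrite mxE scaler_suml; apply: eq_bigr => j _.
by rewrite scalerA !mxE mulrC.
Qed.

(* Replacing l by l + t x in (\prod_(y <- s) y) * l ^+ e.+1 and extracting the
   coefficient of t turns one factor l into x. *)
Lemma waring_sum_prod (F : numClosedFieldType) n d e (s : seq (dhomog n F 1))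
    (l : dhomog n F 1) :
  (0 < d)%N -> (size s + e = d)%N ->
  waring_sum d ((\prod_(x <- s) val x) * val l ^+ e).
Proof.
move=> d0; elim: s e l => [|x s IHs] e l sz_s.
  by exists [:: l]; rewrite big_nil big_seq1 mul1r -sz_s.
pose w (i : 'I_e.+2) : {mpoly F[n]} :=
  (\prod_(y <- s) val y) * (val l ^+ (e.+1 - i) * val x ^+ i) *+ 'C(e.+1, i).
have /waring_sum_coef wP (t : F) : waring_sum d (\sum_(i < e.+2) t ^+ i *: w i).
  have -> : \sum_(i < e.+2) t ^+ i *: w i =
      (\prod_(y <- s) val y) * val (l + t *: x) ^+ e.+1.
    rewrite linearD linearZ /= exprDn mulr_sumr; apply: eq_bigr => i _.
    by rewrite exprZn -scalerAr mulrnAr -scalerAr scalerMnr.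
  by apply: IHs; rewrite addnS.
(* The coefficient of [t] carries the binomial factor [e.+1], invertible in characteristic 0. *)
have {wP} := waring_sumZ (e.+1%:R^-1) d0 (wP d0 (inord 1)).
rewrite /w inordK // bin1 subn1 expr1 -scaler_nat scalerA mulVf ?pnatr_eq0 //.
by rewrite scale1r big_cons (mulrC (val x)) -mulrA (mulrC (val x)).
Qed.

Lemma waring_sum_homog (F : numClosedFieldType) n d (g : {mpoly F[n]}) :
  (0 < d)%N -> g \is d.-homog -> waring_sum d g.
Proof.
move=> d0 /dhomogP hg; rewrite [g]mpolyE big_seq.
apply: waring_sum_big => m /hg deg_m; apply: waring_sumZ => //.
have X1 i : ('X_i : {mpoly F[n]}) \is 1.-homog by rewrite dhomogX /= mdeg1.
pose s := [seq DHomog (X1 i) | i <- mnm_word m].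
have sz_s : size s = d by rewrite size_map size_mnm_word.
(* All [d] factors are variables, so the power in [waring_sum_prod] is the empty one, equal to 1. *)
have -> : 'X_[m] = (\prod_(x <- s) val x) * val (0 : dhomog n F 1) ^+ 0.
  by rewrite mulr1 big_map prod_mnm_word [LHS]mpolyXE_id.
by apply: waring_sum_prod; rewrite // addn0.
Qed.

(** Well-ordering supplies a minimum, so the default 0 of [xget] is not reached. *)
Lemma leastP (P : set nat) : (exists s, P s) -> P (least P).
Proof.
move=> [s Ps]; rewrite /least; case: xgetP => [r -> [] //|no_least].
have exP : exists s, boolp.asbool (P s) by exists s; apply/boolp.asboolP.
case: (ex_minnP exP) => r /boolp.asboolP Pr minr; case: (no_least r).
by split=> // t Pt; apply/minr/boolp.asboolP.
Qed.

Lemma waring_rankP (F : numClosedFieldType) n d (f : dhomog n.+1 F d) :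
  (0 < d)%N -> exists l : 'I_(waring_rank f) -> dhomog n.+1 F 1,
    val f = \sum_(i < waring_rank f) val (l i) ^+ d.
Proof.
move=> d0; apply: (leastP (P := [set s | exists l : 'I_s -> dhomog n.+1 F 1,
  val f = \sum_(i < s) val (l i) ^+ d]%classic)).
have [s fE] := waring_sum_homog d0 (valP f).
by exists (size s), (tnth (in_tuple s)); rewrite fE big_tnth.
Qed.

(** * Evaluation at the linear forms of a decomposition *)

Section Evaluation.
Variables (F : numFieldType) (n d k : nat) (f : dhomog n.+1 F d).
Variables (r s : nat).
Variables (alpha : r.-tuple (dhomog n.+1 F k)) (l : 'I_s -> dhomog n.+1 F 1).
Hypothesis f_sum : val f = \sum_(t < s) val (l t) ^+ d.

Definition eval_mx : 'M[F]_(r, s) :=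
  \matrix_(i, t) (val (tnth alpha i)).@[lincoef (val (l t))].

Lemma apply_diff_sum_exp e (beta : {mpoly F[n.+1]}) : beta \is e.-homog ->
  apply_diff beta (val f) = \sum_(t < s)
    (beta.@[lincoef (val (l t))] *+ (d ^_ e)%N) *: val (l t) ^+ (d - e).
Proof.
move=> hb; rewrite f_sum apply_diff_sum; apply: eq_bigr => t _.
by rewrite (apply_diff_linform_exp _ (valP (l t)) hb).
Qed.

(* A relation between the rows of eval_mx is a form vanishing at every l t,
   hence annihilating f. *)
Lemma eval_mx_free :
  (forall c : {ffun 'I_r -> F},
    \sum_i c i *: tnth alpha i \in Ann_deg f k -> c = [ffun=> 0]) ->
  row_free eval_mx.
Proof.
move=> alpha_free; apply: inj_row_free => v vE0.
pose c : {ffun 'I_r -> F} := [ffun i => v 0 i].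
suff /alpha_free c0 : \sum_i c i *: tnth alpha i \in Ann_deg f k.
  by apply/rowP => i; have /ffunP/(_ i) := c0; rewrite !ffunE mxE.
rewrite mem_Ann_deg inE (apply_diff_sum_exp (valP _)); apply/eqP/big1 => t _.
suff -> : (val (\sum_i c i *: tnth alpha i)).@[lincoef (val (l t))] = 0.
  by rewrite mul0rn scale0r.
have /matrixP/(_ 0 t) := vE0; rewrite !mxE => <-.
rewrite linear_sum raddf_sum; apply: eq_bigr => i _.
by rewrite linearZ /= mevalZ ffunE mxE.
Qed.

(** A product of two [alpha] has degree [k.*2], and its value at a point is the product of their
    values; the Hessian matrix thus factors through [eval_mx]. *)
Lemma hess_sum_exp : hess f alpha =
  \det (map_mx (@mpolyC n.+1 F) eval_mx *m
    diag_mx (\row_t ((d ^_ k.*2)%:R *: val (l t) ^+ (d - k.*2))) *m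
    (map_mx (@mpolyC n.+1 F) eval_mx)^T).
Proof.
rewrite /hess; congr (\det _); apply/matrixP => i j; rewrite !mxE.
rewrite (apply_diff_sum_exp (e := k.*2)); last first.
  by rewrite -addnn; apply: dhomogM; apply: valP.
apply: eq_bigr => t _; rewrite mul_mx_diag !mxE /= mevalM.
by rewrite mulrAC -mpolyCM mul_mpolyC scalerA mulr_natr.
Qed.

End Evaluation.

(** * Nonvanishing of the Hessian and comparison of ranks *)

(** Both [c] and 0 are coordinates of the class of this combination, and [basisA] makes coordinates
    unique. *)
Lemma basisA_free (F : fieldType) n d k (f : dhomog n.+1 F d)
    (alpha : (dimA f k).-tuple (dhomog n.+1 F k)) (c : {ffun 'I_(dimA f k) -> F}) :
  basisA alpha -> \sum_i c i *: tnth alpha i \in Ann_deg f k -> c = [ffun=> 0].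
Proof.
move=> alphaB cA; have [c' [_ uniq_c']] := alphaB (\sum_i c i *: tnth alpha i).
transitivity c'; first by apply/esym/uniq_c'; rewrite subrr mem0v.
by apply: uniq_c'; rewrite [X in _ - X]big1 ?subr0 // => i _; rewrite ffunE scale0r.
Qed.

Lemma meval_lincoef0 (F : numFieldType) n k (p : {mpoly F[n]}) :
  (0 < k)%N -> p \is k.-homog -> p.@[lincoef 0] = 0.
Proof.
move=> k_gt0 /dhomogP hp; rewrite mevalE big1_seq // => m /andP[_ /hp deg_m].
have : mdeg m != 0%N by rewrite [mdeg m]deg_m -lt0n.
rewrite mdegE sum_nat_eq0 negb_forall => /existsP[i /= mi_neq0].
by rewrite (bigD1 i) //= /lincoef mcoeff0 expr0n (negPf mi_neq0) mul0r mulr0.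
Qed.

Lemma hess_neq0 (F : numFieldType) n d k r (f : dhomog n.+1 F d)
    (alpha : r.-tuple (dhomog n.+1 F k)) (l : 'I_r -> dhomog n.+1 F 1) :
  (1 <= k <= d./2)%N -> val f = \sum_(t < r) val (l t) ^+ d ->
  row_free (eval_mx alpha l) -> hess f alpha != 0.
Proof.
move=> /andP[k_gt0 le_kd] f_sum; rewrite row_free_unit unitmxE unitfE => detE.
rewrite (hess_sum_exp alpha f_sum) !det_mulmx det_tr det_map_mx det_diag.
have C0 : (\det (eval_mx alpha l))%:MP_[n.+1] != 0 by rewrite mpolyC_eq0.
rewrite !mulf_neq0 //; apply/prodf_neq0 => t _; rewrite mxE scaler_eq0.
(* The bound [k <= d./2] means [k.*2 <= d], so the falling factorial is positive. *)
rewrite negb_or pnatr_eq0 -lt0n ffact_gt0 -geq_half_double le_kd expf_neq0 //=.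
(* If [l t] were 0, then column [t] of [eval_mx] would vanish because [k > 0]. *)
apply: contraNneq detE => l0; rewrite (expand_det_col _ t) big1 // => i _.
by rewrite mxE [val (l t)]l0 (meval_lincoef0 k_gt0 (valP _)) mul0r.
Qed.

(** The theorem assumes that the border rank equals [dimA f k], so this comparison is what remains
    to be shown. *)
Lemma dimA_lt_waring_rank (F : numClosedFieldType) n d k (f : dhomog n.+1 F d)
    (alpha : (dimA f k).-tuple (dhomog n.+1 F k)) :
  (1 <= k <= d./2)%N -> basisA alpha -> hess f alpha = 0 ->
  (dimA f k < waring_rank f)%N.
Proof.
move=> k_bounds alphaB hess0.
have d_gt0 : (0 < d)%N.
  by case: d k_bounds {f alpha alphaB hess0} => // /andP[/leq_trans/[apply]].
have [l f_sum] := waring_rankP f d_gt0.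
have free := eval_mx_free f_sum (fun c => @basisA_free _ _ _ _ _ _ c alphaB).
(* Independent rows require at least as many columns, one per summand; only equality is left to
   exclude. *)
rewrite ltn_neqAle -{2}(eqP free) rank_leq_col andbT.
(* Rewriting the index type of [l] makes [eval_mx] square. *)
apply/eqP => rank_eq; move: l f_sum free; rewrite -rank_eq => l f_sum free.
by have := hess_neq0 k_bounds f_sum free; rewrite hess0 eqxx.
Qed.

Theorem corollary2p6 (R : realType) (n d : nat) (f : dhomog n.+1 R[i] d)
    (f_concise : concise f) :
  (forall (k : nat) (alpha : (dimA f k).-tuple (dhomog n.+1 R[i] k)),
      (1 <= k <= d./2)%N -> basisA alpha ->
      border_rank f = dimA f k -> hess f alpha = 0 ->
      (border_rank f < waring_rank f)%N) /\
  ((2 <= d)%N ->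
    forall alpha : (dimA f 1).-tuple (dhomog n.+1 R[i] 1),
      basisA alpha ->
      border_rank f = dimA f 1 -> hess f alpha = 0 ->
      (border_rank f < waring_rank f)%N).
Proof.
split=> [k alpha k_bounds alphaB -> hess0|d_ge2 alpha alphaB -> hess0].
  exact: dimA_lt_waring_rank k_bounds alphaB hess0.
apply: dimA_lt_waring_rank alphaB hess0.
by rewrite /= -[1%N]/(2./2) half_leq.
Qed.
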